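(* Let $X$ be a subset of $\mathbb{Q}$ with the property that $X$ has a partition into two disjoint non-empty subsets $X=X_-\cup X_+$ where $X_-<X_+$ and such that $\alpha=\sup X_-$ and $\beta=\inf X_+$ do not belong to $X$. Then there exists a non-regular endomorphism $f$ of $(\mathbb{Q},\leqslant)$ such that the image of $f$ is order-isomorphic to the substructure $(X,\leqslant)$.
   Context: $\operatorname{End}(\mathbb{Q},\leqslant)$ is the monoid, under composition, of all maps $f\colon\mathbb{Q}\to\mathbb{Q}$ such that $u\leqslant v$ implies $uf\leqslant vf$ (maps are written on the right). An element $f$ is regular if there exists $g\in\operatorname{End}(\mathbb{Q},\leqslant)$ with $fgf=f$, and non-regular otherwise. $A<B$ means $a<b$ for all $a\in A$, $b\in B$. Suprema and infima are taken in the extended real line $\mathbb{R}\cup\{\pm\infty\}$ and need not be rational. The image of $f$ carries the order induced from $\mathbb{Q}$. *)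

(* Defs.v *)
From mathcomp Require Import all_boot all_order all_algebra.
From mathcomp Require Import all_classical all_reals ereal.

Set Implicit Arguments.
Unset Strict Implicit.
Unset Printing Implicit Defensive.

Import Order.TTheory GRing.Theory Num.Theory.

Local Open Scope classical_set_scope.
Local Open Scope ring_scope.

Notation EndQ := {omorphism rat -> rat}.

Definition regular_endo (f : EndQ) : Prop := exists g : EndQ, f \o g \o f =1 f.

Definition set_lt (d : Order.disp_t) (T : porderType d) (A B : set T) : Prop :=
  forall a b : T, A a -> B b -> (a < b)%O.

(* The subsets A and B carry the orders induced from T and T'. *)
Definition order_isomorphic (d d' : Order.disp_t) (T : porderType d)
    (T' : porderType d') (A : set T) (B : set T') : Prop :=
  exists h : T -> T',
    set_bij A B h /\
    (forall x y : T, A x -> A y -> (h x <= h y)%O = (x <= y)%O).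

(* A set of rationals seen inside the extended real line, so that its supremum
   and infimum need not be rational. *)
Definition in_ereal (R : realType) (A : set rat) : set (\bar R) :=
  [set (ratr q)%:E | q in A].
Arguments in_ereal : clear implicits.

(* Main.v *)
(* Every non-empty countable chain is the image of an order-preserving map on
   the rationals, so we can choose p with image X and compose it with an
   order embedding e of X that opens a gap around 0 between X_minus and X_plus.
   If f = e \o p had a weak inverse g, then f (g 0) would be the largest element
   of e(X_minus) or the smallest element of e(X_plus). *)
Require Import Defs.
From HB Require Import structures.
From mathcomp Require Import all_boot all_order all_algebra.
From mathcomp Require Import all_classical all_reals ereal.
From mathcomp Require Import lra.

Import Order.TTheory GRing.Theory Num.Theory.

Local Open Scope classical_set_scope.
Local Open Scope ring_scope.

Lemma exists_rat_lt_all_gt (m : rat) (U : seq rat) :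
  {in U, forall u, m < u} -> exists2 q, m < q & {in U, forall u, q < u}.
Proof.
elim: U => [_|u U IH mU]; first by exists (m + 1) => //; lra.
have mu : m < u by apply: mU; rewrite mem_head.
have [q mq qU] : exists2 q, m < q & {in U, forall u, q < u}.
  by apply: IH => v vU; apply: mU; rewrite in_cons vU orbT.
exists (Num.min q ((m + u) / 2)); first by rewrite lt_min mq /=; lra.
move=> v; rewrite in_cons gt_min => /predU1P[->|/qU -> //].
by apply/orP; right; lra.
Qed.

(** Finite form of the density and unboundedness of the rationals; either list may be empty. *)
Lemma exists_rat_between (L U : seq rat) :
  {in L & U, forall l u, l < u} ->
  exists2 q, {in L, forall l, l < q} & {in U, forall u, q < u}.
Proof.
elim: L => [_|l L IH LU].
  elim: U => [|u U [q _ qU]]; first by exists 0.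
  exists (Num.min q (u - 1)) => // v.
  rewrite in_cons gt_min => /predU1P[->|/qU -> //].
  by apply/orP; right; lra.
have [q Lq qU] : exists2 q, {in L, forall l, l < q} & {in U, forall u, q < u}.
  by apply: IH => v u vL; apply: LU; rewrite in_cons vL orbT.
(* If [q <= l], any point above [l] also exceeds the rest of [L], which lies below [q]; it only has
   to stay below [U]. *)
have [lq|ql] := ltP l q.
  by exists q => // v; rewrite in_cons => /predU1P[->|/Lq].
have [r lr rU] : exists2 r, l < r & {in U, forall u, r < u}.
  by apply: exists_rat_lt_all_gt => u; apply: LU; rewrite mem_head.
exists r => // v; rewrite in_cons => /predU1P[-> //|/Lq vq].
exact: lt_trans (lt_le_trans vq ql) lr.
Qed.

(** A finite approximation to a monotone map into [A]. Equal abscissas satisfy the inequality in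
    both directions, so antisymmetry makes the list single-valued. *)
Definition monotone_graph (d : Order.disp_t) (T : orderType d) (A : set T)
    (s : seq (rat * T)) : Prop :=
  {in s, forall p, A p.2} /\
  {in s &, forall p p', p.1 <= p'.1 -> (p.2 <= p'.2)%O}.

Lemma monotone_graph_cons (d : Order.disp_t) (T : orderType d) (A : set T)
    (s : seq (rat * T)) (q : rat) (x : T) :
  monotone_graph _ _ A s -> A x ->
  {in s, forall p, (p.1 <= q -> (p.2 <= x)%O) /\ (q <= p.1 -> (x <= p.2)%O)} ->
  monotone_graph _ _ A ((q, x) :: s).
Proof.
move=> [sA smono] Ax sqx; split=> [p|p p']; rewrite !in_cons.
  by move=> /predU1P[->|/sA].
move=> /predU1P[->|ps] /predU1P[->|p's] //=.
- by case: (sqx _ p's) => _; apply.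
- by case: (sqx _ ps) => + _; apply.
- exact: smono.
Qed.

(** Since values may repeat, the new one can be taken among [x0] and the values already in the
    list. *)
Lemma monotone_graph_extend_dom (d : Order.disp_t) (T : orderType d)
    (A : set T) (s : seq (rat * T)) (q : rat) :
  A !=set0 -> monotone_graph _ _ A s ->
  exists x, monotone_graph _ _ A ((q, x) :: s).
Proof.
move=> [x0 Ax0] sA.
suff [x Ax sx] : exists2 x, A x &
    {in s, forall p, (p.1 <= q -> (p.2 <= x)%O) /\ (q <= p.1 -> (x <= p.2)%O)}.
  by exists x; apply: monotone_graph_cons.
elim: s sA => [_|p s IH [psA psmono]]; first by exists x0.
have [x Ax sx] : exists2 x, A x &
    {in s, forall p, (p.1 <= q -> (p.2 <= x)%O) /\ (q <= p.1 -> (x <= p.2)%O)}.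
  apply: IH; split=> [p' p's|p1 p2 p1s p2s].
    by apply: psA; rewrite in_cons p's orbT.
  by apply: psmono; rewrite in_cons ?p1s ?p2s orbT.
have pA : A p.2 by apply: psA; rewrite mem_head.
have pmono p' : p' \in s ->
    (p.1 <= p'.1 -> (p.2 <= p'.2)%O) /\ (p'.1 <= p.1 -> (p'.2 <= p.2)%O).
  by move=> p's; split; apply: psmono; rewrite in_cons ?eqxx ?p's ?orbT.
(* The value [x] suits the tail. It is raised to [p.2] if [p] lies left of [q], lowered to it if [p]
   lies right, and replaced by it if the abscissas agree; [pmono] keeps the tail satisfied. *)
case: (ltgtP p.1 q) => pq.
- exists (Order.max p.2 x); first by case: leP.
  move=> p'; rewrite in_cons => /predU1P[->|p's].
    by split=> [_|/(lt_le_trans pq)]; rewrite ?ltxx // le_max lexx.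
  have [p'x xp'] := sx _ p's; have [pp' _] := pmono _ p's.
  split=> [/p'x h|qp']; first by rewrite le_max h orbT.
  by rewrite ge_max xp' // pp' // (le_trans (ltW pq)).
- exists (Order.min p.2 x); first by case: leP.
  move=> p'; rewrite in_cons => /predU1P[->|p's].
    by split=> [/(lt_le_trans pq)|_]; rewrite ?ltxx // ge_min lexx.
  have [p'x xp'] := sx _ p's; have [_ pp'] := pmono _ p's.
  split=> [p'q|/xp' h]; last by rewrite ge_min h orbT.
  by rewrite le_min p'x // pp' // (le_trans p'q (ltW pq)).
- exists p.2 => // p'; rewrite in_cons -pq => /predU1P[-> //|/pmono[? ?]].
  by split.
Qed.

(* Points with equal values may be repeated, so the new abscissa only has to
   avoid the points with strictly smaller or strictly larger values. *)
Lemma monotone_graph_extend_codom (d : Order.disp_t) (T : orderType d)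
    (A : set T) (s : seq (rat * T)) (x : T) :
  A x -> monotone_graph _ _ A s ->
  exists q, monotone_graph _ _ A ((q, x) :: s).
Proof.
move=> Ax sA; have [_ smono] := sA.
have [l u|q Lq qU] := exists_rat_between
    [seq p.1 | p <- s & (p.2 < x)%O] [seq p.1 | p <- s & (x < p.2)%O].
  move=> /mapP[p + ->] /mapP[p' + ->].
  rewrite !mem_filter => /andP[px ps] /andP[xp' p's].
  rewrite ltNge; apply/negP => /(smono _ _ p's ps).
  by rewrite leNgt (lt_trans px xp').
exists q; apply: monotone_graph_cons => // p ps; split; apply: contraTT.
  rewrite -!ltNge => xp; apply: qU; apply/mapP.
  by exists p; rewrite // mem_filter xp.
rewrite -!ltNge => px; apply: Lq; apply/mapP.
by exists p; rewrite // mem_filter px.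
Qed.

(* Back-and-forth, where the back step needs density of the domain only. *)
Lemma exists_homo_rat_onto (d : Order.disp_t) (T : orderType d)
    (a : nat -> T) :
  exists p : rat -> T,
    {homo p : x y / x <= y >-> (x <= y)%O} /\ range p = range a.
Proof.
pose e n : rat := odflt 0 (unpickle n).
pose A := range a.
have A0 : A !=set0 by exists (a 0); exists 0%N.
(* Monotonicity is a premise under the existential, so that [choice] gives a function total on all
   lists; the value [[::]] on bad lists is junk. *)
have step (ns : nat * seq (rat * T)) : exists s', monotone_graph _ _ A ns.2 ->
    [/\ monotone_graph _ _ A s', {subset ns.2 <= s'},
        exists x, (e ns.1, x) \in s' & exists q, (q, a ns.1) \in s'].
  case: ns => n s /=.
  have [sA|] := pselect (monotone_graph _ _ A s); last by exists [::].
  have [x xsA] := monotone_graph_extend_dom _ _ A s (e n) A0 sA.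
  have [|q qxsA] := monotone_graph_extend_codom _ _ A _ (a n) _ xsA.
    by exists n.
  exists [:: (q, a n), (e n, x) & s] => _; split=> //.
  - by move=> p ps; rewrite !in_cons ps !orbT.
  - by exists x; rewrite !in_cons eqxx orbT.
  - by exists q; rewrite mem_head.
have [F FP] := choice step.
pose st := fix st n := if n is m.+1 then F (m, st m) else [::].
have stA n : monotone_graph _ _ A (st n).
  by elim: n => [|n /(FP (n, st n))[]//]; split.
have stS m n : (m <= n)%N -> {subset st m <= st n}.
  elim: n => [|n IH]; first by rewrite leqn0 => /eqP->.
  rewrite leq_eqVlt => /predU1P[-> //|/IH mn p /mn].
  by have [_ + _ _] := FP (n, st n) (stA n); apply.
(* The union of the increasing stages; two of its points always lie in a common stage. *)
pose G q x := exists n, (q, x) \in st n.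
have Gmono q x q' x' : G q x -> G q' x' -> q <= q' -> (x <= x')%O.
  move=> [n qx] [n' qx'] qq'.
  have [_ smono] := stA (maxn n n').
  apply: (smono (q, x) (q', x')) => //.
    exact: stS (leq_maxl _ _) _ qx.
  exact: stS (leq_maxr _ _) _ qx'.
have Gtot q : exists x, G q x.
  have [_ _ [x] + _] := FP (pickle q, st (pickle q)) (stA _).
  by rewrite /e pickleK => qx; exists x, (pickle q).+1.
have [p pG] := choice Gtot.
exists p; split=> [x y|]; first exact: Gmono.
apply/seteqP; split=> [_ [q _ <-]|_ [n _ <-]].
  by have [n qn] := pG q; have [/(_ _ qn)] := stA n.
have [_ _ _ [q qn]] := FP (n, st n) (stA n).
have Gq : G q (a n) by exists n.+1.
(* [p q] and [a n] are both [G]-values at [q], and [Gmono] at equal abscissas forces them to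
   coincide. *)
by exists q => //; apply/le_anti; rewrite !(Gmono q _ q).
Qed.

Lemma exists_homo_rat_onto_set (A : set rat) : A !=set0 ->
  exists p : rat -> rat, {homo p : x y / x <= y} /\ range p = A.
Proof.
move=> [x0 Ax0].
(* An enumeration of [A] with repetitions: [x0] stands in for codes of no rational or of one outside
   [A]. *)
pose a n := if unpickle n is Some q then if pselect (A q) then q else x0 else x0.
have [p [p_homo pa]] := exists_homo_rat_onto _ _ a.
exists p; split=> //; rewrite pa; apply/seteqP; split=> [_ [n _ <-]|q Aq].
  by rewrite /a; case: unpickle => // q; case: pselect.
by exists (pickle q) => //; rewrite /a pickleK; case: pselect.
Qed.

(** A largest element of [A] would be its supremum, and it lies in [X]. *)
Lemma ereal_sup_notin_no_max (R : realType) (A X : set rat) :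
  A `<=` X -> ~ in_ereal R X (ereal_sup (in_ereal R A)) ->
  forall x, A x -> exists2 y, A y & x < y.
Proof.
move=> AX supX x Ax; apply: contrapT => noy; apply: supX.
exists x; first exact: AX.
apply/le_anti/andP; split.
  by apply: ereal_sup_ubound; exists x.
apply: ge_ereal_sup => _ [y Ay <-]; rewrite lee_fin ler_rat leNgt.
by apply/negP => xy; apply: noy; exists y.
Qed.

Lemma ereal_inf_notin_no_min (R : realType) (A X : set rat) :
  A `<=` X -> ~ in_ereal R X (ereal_inf (in_ereal R A)) ->
  forall x, A x -> exists2 y, A y & y < x.
Proof.
move=> AX infX x Ax; apply: contrapT => noy; apply: infX.
exists x; first exact: AX.
apply/le_anti/andP; split; last by apply: ereal_inf_lbound; exists x.
apply: le_ereal_inf_tmp => _ [y Ay <-]; rewrite lee_fin ler_rat leNgt.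
by apply/negP => yx; apply: noy; exists y.
Qed.

(** If [f x < c], then [f x = f (g (f x)) <= f (g c)] by monotonicity, and dually above [c]. So
    [f (g c)], on whichever side of [c] it falls, would be extremal there. *)
Lemma gap_non_regular (f : EndQ) (c : rat) :
  (forall x, f x != c) ->
  (forall x, f x < c -> exists2 y, f y < c & f x < f y) ->
  (forall x, c < f x -> exists2 y, c < f y & f y < f x) ->
  ~ regular_endo f.
Proof.
move=> fc nomax nomin [g fgf].
have fgc x : f x < c -> f x <= f (g c).
  by move=> xc; rewrite -[leLHS]fgf /=; do 2!apply: omorph_le; exact: ltW.
have cfg x : c < f x -> f (g c) <= f x.
  by move=> cx; rewrite -[leRHS]fgf /=; do 2!apply: omorph_le; exact: ltW.
have := fc (g c); rewrite neq_lt => /orP[/nomax|/nomin] [y yc].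
  by rewrite ltNge fgc.
by rewrite ltNge cfg.
Qed.

Theorem theorem3p10 (R : realType) (X X_minus X_plus : set rat)
    (X_partition : X = X_minus `|` X_plus)
    (X_disjoint : X_minus `&` X_plus = set0)
    (X_minus_nonempty : X_minus !=set0)
    (X_plus_nonempty : X_plus !=set0)
    (X_minus_lt_plus : set_lt X_minus X_plus)
    (alpha_notin_X : ~ in_ereal R X (ereal_sup (in_ereal R X_minus)))
    (beta_notin_X : ~ in_ereal R X (ereal_inf (in_ereal R X_plus))) :
  exists f : EndQ, ~ regular_endo f /\ order_isomorphic (range f) X.
Proof.
have [a Xa] := X_minus_nonempty; have [b Xb] := X_plus_nonempty.
have ab := X_minus_lt_plus _ _ Xa Xb.
have subm : X_minus `<=` X by rewrite X_partition => x; left.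
have subp : X_plus `<=` X by rewrite X_partition => x; right.
have nomax := ereal_sup_notin_no_max _ _ _ subm alpha_notin_X.
have nomin := ereal_inf_notin_no_min _ _ _ subp beta_notin_X.
have [p [p_homo pX]] := exists_homo_rat_onto_set X
  (ex_intro _ a (subm _ Xa)).
have Xp x : X (p x) by rewrite -pX; exists x.
have pE x : X x -> exists y, p y = x by rewrite -pX => -[y _ <-]; exists y.
(* Since a <= X_plus and X_minus <= b, this opens a gap around the rational 0,
   even when alpha = beta is irrational. *)
pose e x : rat := if pselect (X_minus x) then x - b else x - a.
have em x : X_minus x -> e x = x - b by rewrite /e; case: pselect.
have ep x : X_plus x -> e x = x - a.
  rewrite /e; case: pselect => // xm xp.
  by have := X_minus_lt_plus _ _ xm xp; rewrite ltxx.
have em0 x : X_minus x -> e x < 0.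
  by move=> xm; have := X_minus_lt_plus _ _ xm Xb; rewrite em //; lra.
have ep0 x : X_plus x -> 0 < e x.
  by move=> xp; have := X_minus_lt_plus _ _ Xa xp; rewrite ep //; lra.
have sides x : X x -> X_minus x \/ X_plus x by rewrite X_partition.
have e_lt x y : X x -> X y -> x < y -> e x < e y.
  move=> /sides[xm|xp] /sides[ym|yp] xy.
  - by rewrite !em //; lra.
  - exact: lt_trans (em0 _ xm) (ep0 _ yp).
  - by have := lt_trans xy (X_minus_lt_plus _ _ ym xp); rewrite ltxx.
  - by rewrite !ep //; lra.
have e_mono : {in X &, {mono e : x y / x <= y}}.
  apply: le_mono_in => x y /set_mem Xx /set_mem Xy; exact: e_lt.
have ep_homo : {homo e \o p : x y / x <= y}.
  by move=> x y xy /=; rewrite e_mono ?mem_set //; exact: p_homo.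
pose f : EndQ := HB.pack (e \o p)
  (Order.isOrderMorphism.Build _ _ _ _ (e \o p) ep_homo).
exists f; split.
  apply: (@gap_non_regular f 0) => x; rewrite /= -/(e (p x)).
  - by case: (sides _ (Xp x)) => [/em0|/ep0]; rewrite neq_lt => ->; rewrite ?orbT.
  - case: (sides _ (Xp x)) => [xm _|/ep0 xp /(lt_trans xp)]; last by rewrite ltxx.
    have [y ym xy] := nomax _ xm; have [z zy] := pE _ (subm _ ym).
    (* A larger [y] in [X_minus] is a value of [p], so [f] takes the larger value [e y], still below
       0. *)
    by exists z; rewrite zy; [exact: em0|apply: e_lt => //; exact: subm].
  - case: (sides _ (Xp x)) => [/em0 xm /(lt_trans xm)|xp _]; first by rewrite ltxx.
    have [y yp yx] := nomin _ xp; have [z zy] := pE _ (subp _ yp).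
    by exists z; rewrite zy; [exact: ep0|apply: e_lt => //; exact: subp].
(* The inverse of [e] on [e(X)]: the sign tells which of the two translations to undo. *)
pose h y : rat := if y < 0 then y + b else y + a.
have eK x : X x -> h (e x) = x.
  move=> /sides[xm|xp]; rewrite /h; first by rewrite em0 // em // subrK.
  by rewrite ltNge (ltW (ep0 _ xp)) /= ep // subrK.
exists h; split; last first.
  by move=> _ _ [x _ <-] [y _ <-]; rewrite /= !eK // e_mono ?mem_set.
split.
- by move=> _ [x _ <-]; rewrite /= eK.
- move=> _ _ /set_mem[x _ <-] /set_mem[y _ <-].
  by rewrite /= !eK // => ->.
- by move=> x Xx; have [y yx] := pE _ Xx; exists (f y); [exists y|rewrite /= yx eK].
Qed.
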